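(* Let $\epsilon\in(0,\gamma]$ and let $u_1^\epsilon$, $u_2^\epsilon$ be the values of the $\epsilon$-obstacle tug-of-war games with boundary functions $F_1,F_2$ and obstacles $\Psi_1,\Psi_2$ respectively. If $F_1\ge F_2$ and $\Psi_1\ge\Psi_2$, then $u_1^\epsilon\ge u_2^\epsilon$.
   Context: Setting. $\Omega\subset\mathbb R^N$ is a bounded smooth domain, $\gamma>0$ is fixed, and $\Gamma=\{x\in\mathbb R^N\setminus\Omega:\operatorname{dist}(x,\partial\Omega)\le\gamma\}$. For each game the final payoff (boundary function) $F:\Gamma\to\mathbb R$ is Lipschitz, and the obstacle $\Psi:\mathbb R^N\to\mathbb R$ is Lipschitz with $\Psi\le F$ in $\Gamma$; this applies to $(F,\Psi)=(F_1,\Psi_1)$ and to $(F_2,\Psi_2)$, with the same $\Omega$, $\Gamma$. $B_\epsilon(x)$ is the ball of radius $\epsilon$ centered at $x$. The $\epsilon$-obstacle tug-of-war game ($0<\epsilon\le\gamma$). A token starts at $x_0$. If $x_0\in\Gamma$ the game ends at once. At each stage $k$ with $x_k\in\Omega$, Player I may end the game; otherwise each player $i\in\{I,II\}$ chooses an action $a_k^i\in B_\epsilon(x_k)$, a fair coin is tossed, and $x_{k+1}=a_k^I$ or $x_{k+1}=a_k^{II}$ with probability $1/2$ each. The game also ends when the token reaches $\Gamma$. When the game ends at position $x_\tau$, Player II pays Player I the amount $\tilde F(x_\tau)$, where $\tilde F=F$ on $\Gamma$ and $\tilde F=\Psi$ on $\Omega$. A strategy $S_i$ of Player $i$ is a sequence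 of Borel-measurable maps sending each history $(x_0,a_0,x_1,\dots,a_{k-1},x_k)$ (where $a_j=(a_j^I,a_j^{II})$) to a point of $B_\epsilon(x_k)$. A stopping rule $\tau$ for Player I is a finite, Borel-measurable stopping time with values in $\mathbb N=\{0,1,2,\dots\}$ with respect to the histories ($\tau=k$ means that Player I ends the game at stage $k$, if it has not ended already). These data induce a probability on plays with expectation $\mathbb E^{x_0}_{\tau,S_I,S_{II}}$. Let $V_{x_0,I}(\tau,S_I,S_{II})=V_{x_0,II}(\tau,S_I,S_{II})=\mathbb E^{x_0}_{\tau,S_I,S_{II}}[\tilde F(x_\tau)]$ ($x_\tau$ the terminal position) if the game terminates almost surely, and otherwise $V_{x_0,I}=-\infty$, $V_{x_0,II}=+\infty$. The values for the two players are $$u_I^\epsilon(x_0)=\sup_{\tau,S_I}\inf_{S_{II}}V_{x_0,I}(\tau,S_I,S_{II}),\qquad u_{II}^\epsilon(x_0)=\inf_{S_{II}}\sup_{\tau,S_I}V_{x_0,II}(\tau,S_I,S_{II}),$$ and the value of the game is the common function $u^\epsilon=u_I^\epsilon=u_{II}^\epsilon$ on $\Omega\cup\Gamma$ (the two coincide). The inequalities in the claim are pointwise on $\Gamma$ (for $F_i$), on $\mathbb R^N$ (for $\Psi_i$) and on $\Omega\cup\Gamma$ (for $u_i^\epsilon$). *)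

(* Defs.v *)
From HB Require Import structures.
From mathcomp Require Import all_boot all_order all_algebra.
From mathcomp Require Import all_classical all_reals all_analysis.

Set Implicit Arguments.
Unset Strict Implicit.
Unset Printing Implicit Defensive.

Import Order.TTheory GRing.Theory Num.Theory.
Import numFieldNormedType.Exports.

Local Open Scope classical_set_scope.
Local Open Scope ring_scope.

(* The norm `|x| of the library on 'rV[R]_N is the sup norm; it induces the
   Euclidean topology and boundedness, but the metric notions of the game
   (balls, distance, Lipschitz constants) use the Euclidean norm below. *)
Definition enorm (R : realType) (N : nat) (x : 'rV[R]_N) : R :=
  Num.sqrt (\sum_(i < N) x ord0 i ^+ 2).

Definition eball (R : realType) (N : nat) (x : 'rV[R]_N) (r : R)
  : set 'rV[R]_N := [set y | enorm (y - x) < r].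

Definition edist (R : realType) (N : nat) (x : 'rV[R]_N) (A : set 'rV[R]_N)
  : R := inf [set enorm (x - y) | y in A].

Definition elipschitz (R : realType) (N : nat) (A : set 'rV[R]_N)
    (f : 'rV[R]_N -> R) : Prop :=
  exists L : R, forall x y, A x -> A y -> `|f x - f y| <= L * enorm (x - y).

Definition boundary (T : topologicalType) (A : set T) : set T :=
  closure A `\` interior A.

Definition partial (R : realType) (N : nat) (i : 'I_N) (f : 'rV[R]_N -> R)
  : 'rV[R]_N -> R := fun x => 'D_(delta_mx ord0 i) f x.

Definition smooth_on (R : realType) (N : nat) (U : set 'rV[R]_N)
    (f : 'rV[R]_N -> R) : Prop :=
  forall (s : seq 'I_N) (x : 'rV[R]_N), U x ->
    {for x, continuous (foldr (@partial R N) f s)} /\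
    forall i, derivable (foldr (@partial R N) f s) x (delta_mx ord0 i).

(* Near each boundary point the domain is a strict sublevel set of a smooth
   function without critical points. *)
Definition smooth_boundary (R : realType) (N : nat) (Om : set 'rV[R]_N)
  : Prop :=
  forall x, boundary Om x ->
    exists (U : set 'rV[R]_N) (phi : 'rV[R]_N -> R),
      [/\ open U, U x, smooth_on U phi,
          (forall y, U y -> exists i, partial i phi y != 0) &
          (forall y, U y -> (Om y <-> phi y < 0))].

Definition bounded_smooth_domain (R : realType) (N : nat)
    (Om : set 'rV[R]_N) : Prop :=
  [/\ open Om, connected Om, Om !=set0, bounded_set Om & smooth_boundary Om].

Definition strip (R : realType) (N : nat) (Om : set 'rV[R]_N) (gamma : R)
  : set 'rV[R]_N :=
  [set x | ~ Om x /\ edist x (boundary Om) <= gamma].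

Definition obstacle_data (R : realType) (N : nat) (Om : set 'rV[R]_N)
    (gamma : R) (F Psi : 'rV[R]_N -> R) : Prop :=
  [/\ elipschitz (strip Om gamma) F, elipschitz setT Psi &
      forall x, strip Om gamma x -> Psi x <= F x].

(* R^N with its Borel sigma-algebra. *)
Notation Rn R N := (g_sigma_algebraType (@open 'rV[R]_N)).

(* One stage (x_k, (a_k^I, a_k^II)), and the histories
   ((x_0, a_0), ..., (x_(k-1), a_(k-1))), x_k. *)
Notation stage R N := (Rn R N * (Rn R N * Rn R N))%type.
Notation history R N k := (k.-tuple (stage R N) * Rn R N)%type.

(* Infinite plays (x_k, a_k)_k, with the product sigma-algebra. *)
Definition coordinate_sets (R : realType) (N : nat)
  : set (set (nat -> stage R N)) :=
  [set A | exists k (B : set (stage R N)),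
     measurable B /\ A = (fun w => w k) @^-1` B].

Notation play R N := (g_sigma_algebraType (@coordinate_sets R N)).

Definition position (R : realType) (N : nat) (w : play R N) (k : nat)
  : 'rV[R]_N := (w k).1.

Definition history_of (R : realType) (N : nat) (k : nat) (w : play R N)
  : history R N k := ([tuple w i | i < k], (w k).1).

Record strategy (R : realType) (N : nat) (eps : R) := Strategy {
  action :> forall k : nat, history R N k -> Rn R N;
  strategy_measurable : forall k, measurable_fun setT (@action k);
  strategy_in_ball : forall k (h : history R N k), eball h.2 eps (action h)
}.

(* The event {tau = k} belongs to the sigma-algebra generated by the history
   up to stage k. *)
Record stopping_rule (R : realType) (N : nat) := StoppingRule {
  stop :> play R N -> nat;
  stop_adapted : forall k, exists2 A : set (history R N k),
    measurable A & stop @^-1` [set k] = @history_of R N k @^-1` A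
}.

(* The fair coins: binary digits of a uniform point of [0, 1]. *)
Definition coin (R : realType) (k : nat) (t : R) : bool :=
  odd (Num.truncn (2 ^+ k.+1 * t)).

Definition coin_prob (R : realType) : probability (measurableTypeR R) R :=
  uniform_prob (@ltr01 R).

Definition next_history (R : realType) (N : nat) (eps : R)
    (SI SII : strategy N eps) (k : nat) (c : bool) (h : history R N k)
  : history R N k.+1 :=
  ([tuple of rcons h.1 (h.2, (SI k h, SII k h))],
   if c then SI k h else SII k h).

Fixpoint random_history (R : realType) (N : nat) (eps : R) (x0 : 'rV[R]_N)
    (SI SII : strategy N eps) (k : nat) (t : R) : history R N k :=
  match k with
  | 0 => ([tuple], x0)
  | k'.+1 => next_history SI SII (coin k' t) (random_history x0 SI SII k' t)
  end.

(* The play continues formally after it has ended; what happens then does not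
   enter the payoff. *)
Definition random_play (R : realType) (N : nat) (eps : R) (x0 : 'rV[R]_N)
    (SI SII : strategy N eps) (t : measurableTypeR R) : play R N :=
  fun k => let h := random_history x0 SI SII k t in
           (h.2, (SI k h, SII k h)).

Definition dyadic (R : realType) (k : nat) (t : R) : nat :=
  Num.truncn (2 ^+ k * t).

Lemma dyadicS (R : realType) (k : nat) (t : R) :
  (dyadic k.+1 t)./2 = dyadic k t.
Proof.
rewrite /dyadic exprS -mulrA; set y := 2 ^+ k * t.
have [y0|y0] := leP 0 y; last first.
  have tr0 (z : R) : z < 0 -> Num.truncn z = 0%N.
    by move=> z0; apply/truncn0Pn; rewrite -ltNge (lt_trans z0).
  by rewrite !tr0// pmulr_rlt0.
apply/esym/truncn_def; have /andP[le1 le2] := truncn_itv (mulr_ge0 (ler0n R 2) y0).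
set n := Num.truncn (2 * y) in le1 le2 *.
have hn := odd_double_half n.
apply/andP; split.
  rewrite -(ler_pM2l (ltr0n R 2)) -natrM (le_trans _ le1)// ler_nat.
  by rewrite mul2n -{2}hn leq_addl.
rewrite -(ltr_pM2l (ltr0n R 2)) -natrM (lt_le_trans le2)// ler_nat.
by rewrite mul2n doubleS -{1}hn; case: (odd n).
Qed.

Lemma measurable_dyadic (R : realType) (k : nat) (d : measure_display)
    (T : measurableType d) (g : nat -> T) :
  measurable_fun [set: measurableTypeR R] (fun t => g (dyadic k t)).
Proof.
have mle n : measurable [set t : measurableTypeR R | (dyadic k t <= n)%N].
  rewrite (_ : [set _ | _] = `]-oo, (n.+1%:R / 2 ^+ k : R)[%classic).
    exact: measurable_itv.
  apply/seteqP; split=> t; rewrite /= in_itv/= /dyadic truncn_le_nat;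
    by rewrite ltr_pdivlMr ?exprn_gt0// mulrC.
have meq n : measurable [set t : measurableTypeR R | dyadic k t = n].
  case: n => [|n].
    rewrite (_ : [set _ | _] =
        [set t : measurableTypeR R | (dyadic k t <= 0)%N])//.
    by apply/seteqP; split=> t /=; rewrite leqn0 => /eqP.
  rewrite (_ : [set _ | _] = [set t : measurableTypeR R | (dyadic k t <= n.+1)%N]
    `\` [set t : measurableTypeR R | (dyadic k t <= n)%N]).
    exact: measurableD.
  apply/seteqP; split=> t /=; first by move=> ->; split=> //; rewrite ltnn.
  by move=> [h1 /negP]; rewrite -ltnNge => h2; apply/eqP; rewrite eqn_leq h1.
move=> _ A mA; rewrite setTI.
rewrite (_ : _ @^-1` _ = \bigcup_(n in [set n | A (g n)])
   [set t : measurableTypeR R | dyadic k t = n]).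
  by apply: bigcup_measurable => n _; exact: meq.
apply/seteqP; split=> t /=; first by move=> h; exists (dyadic k t).
by case=> n /= h E; rewrite E.
Qed.

Lemma coin_prob_dyadic1 (R : realType) (k n : nat) : (n < 2 ^ k)%N ->
  coin_prob R [set t | dyadic k t = n] = ((2 ^- k)%:E : \bar R).
Proof.
move=> nk; have k0 : 0 < 2 ^+ k :> R by rewrite exprn_gt0.
rewrite /coin_prob /= /uniform_prob integral_uniform_pdf.
have -> : [set t : R | dyadic k t = n] `&` `[0, 1]%classic =
    `[n%:R / 2 ^+ k, n.+1%:R / 2 ^+ k[%classic.
  apply/seteqP; split=> t /=; rewrite !in_itv/= ler_pdivrMr// ltr_pdivlMr//;
    rewrite [t * _]mulrC.
  - move=> [<- /andP[t0 t1]]; apply: truncn_itv.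
    by rewrite mulr_ge0// ltW.
  - move=> h; split; first exact: truncn_def.
    have /andP[h1 h2] := h; apply/andP; split.
      by rewrite -(pmulr_rge0 _ k0) (le_trans _ h1).
    rewrite -(ler_pM2l k0) mulr1 (le_trans (ltW h2))//.
    by rewrite -natrX ler_nat.
rewrite (eq_integral (cst 1%E)); last first.
  move=> t; rewrite inE/= in_itv/= => /andP[h1 h2].
  rewrite /uniform_pdf subr0 invr1 (le_trans _ h1) ?divr_ge0 ?(ltW k0)//=.
  by rewrite (le_trans (ltW h2))// ler_pdivrMr// mul1r -natrX ler_nat.
rewrite integral_cst//= mul1e lebesgue_measure_itv/= lte_fin.
rewrite ltr_pM2r ?invr_gt0// ltr_nat ltnSn.
by rewrite -EFinD -mulrBl -natrB// subSnn mul1r.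
Qed.

Lemma coin_prob_dyadic (R : realType) (k : nat) (B : set nat) :
  coin_prob R [set t | B (dyadic k t)] =
  ((2 ^- k * \sum_(n < 2 ^ k) (`[< B n >])%:R)%:E : \bar R).
Proof.
have mB (C : set nat) : measurable [set t : measurableTypeR R | C (dyadic k t)].
  rewrite -[X in measurable X]setTI.
  have := @measurable_dyadic R k _ bool (fun n => `[< C n >]) measurableT
    [set true] I.
  by congr (measurable (_ `&` _)); apply/seteqP; split=> t /= /asboolP.
have fin (C : set nat) : coin_prob R [set t | (C (dyadic k t)) /\
      (dyadic k t < 2 ^ k)%N] =
    ((2 ^- k * \sum_(n < 2 ^ k) (`[< C n >])%:R)%:E : \bar R).
  have -> : [set t : R | C (dyadic k t) /\ (dyadic k t < 2 ^ k)%N] =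
     \big[setU/set0]_(n < 2 ^ k | `[< C n >]) [set t | dyadic k t = n].
    rewrite -bigcup_seq_cond; apply/seteqP; split=> t /=.
      move=> [Ct lt]; exists (Ordinal lt) => //=.
      by rewrite mem_index_enum; apply/asboolP.
    move=> [n /= /andP[_ /asboolP Cn] tn].
    by rewrite tn; split.
  rewrite measure_bigsetU_ord.
  - rewrite (eq_bigr (fun=> (2 ^- k)%:E)); last first.
      by move=> n _; exact: coin_prob_dyadic1.
    by rewrite sumEFin mulr_sumr big_mkcond/=; congr (_%:E);
      apply: eq_bigr => n _; case: asboolP; rewrite ?mulr1 ?mulr0.
  - by move=> n; exact: (mB [set (n : nat)]).
  - by move=> i j _ _ [t [/= -> ij]]; exact: val_inj.
have all1 : coin_prob R [set t | (dyadic k t < 2 ^ k)%N] = 1%E.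
  have := fin setT; rewrite (eq_bigr (fun=> 1)); last first.
    by move=> i _; rewrite asboolT.
  rewrite sumr_const card_ord natrX mulVf ?expf_neq0// => <-.
  by congr (coin_prob R _); apply/seteqP; split=> t //= [].
rewrite -fin.
have -> : [set t : R | B (dyadic k t) /\ (dyadic k t < 2 ^ k)%N] =
  [set t | B (dyadic k t)] `&` [set t | (dyadic k t < 2 ^ k)%N] by [].
rewrite [LHS](@measureDI _ _ _ (coin_prob R) _ [set t | (dyadic k t < 2 ^ k)%N]).
- rewrite [X in (X + _)%E](_ : _ = 0%E) ?add0e//.
  apply: (@subset_measure0 _ _ _ (coin_prob R) _
    (~` [set t | (dyadic k t < 2 ^ k)%N])).
  + apply: measurableD; [exact: mB|exact: (mB [set n | n < 2 ^ k]%N)].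
  + apply: measurableC; exact: (mB [set n | n < 2 ^ k]%N).
  + by move=> t [].
  + apply: etrans (probability_setC (coin_prob R)
      (mB [set n | n < 2 ^ k]%N)) _.
    by rewrite all1 subee.
- exact: mB.
- exact: (mB [set n | n < 2 ^ k]%N).
Qed.

Fixpoint digit_history (R : realType) (N : nat) (eps : R) (x0 : 'rV[R]_N)
    (SI SII : strategy N eps) (k n : nat) : history R N k :=
  match k with
  | 0 => ([tuple], x0)
  | k'.+1 => next_history SI SII (odd n) (digit_history x0 SI SII k' n./2)
  end.

Lemma random_historyE (R : realType) (N : nat) (eps : R) (x0 : 'rV[R]_N)
    (SI SII : strategy N eps) (k : nat) (t : R) :
  random_history x0 SI SII k t = digit_history x0 SI SII k (dyadic k t).
Proof. by elim: k => //= k ->; rewrite dyadicS. Qed.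

Lemma measurable_random_play (R : realType) (N : nat) (eps : R)
    (x0 : 'rV[R]_N) (SI SII : strategy N eps) :
  measurable_fun setT (random_play x0 SI SII).
Proof.
apply: (@measurability _ _ _ (play R N) _ _ (@coordinate_sets R N) erefl).
move=> _ [_ [k [B [mB ->]] <-]].
pose g n := let h := digit_history x0 SI SII k n in (h.2, (SI k h, SII k h)).
have := @measurable_dyadic R k _ _ g measurableT B mB.
by congr (measurable (_ `&` _)); apply/seteqP; split=> t;
  rewrite /= /random_play random_historyE.
Qed.

HB.instance Definition _ (R : realType) (N : nat) (eps : R) (x0 : 'rV[R]_N)
    (SI SII : strategy N eps) :=
  @isMeasurableFun.Build _ _ _ _ (random_play x0 SI SII)
    (measurable_random_play x0 SI SII).

Definition play_law (R : realType) (N : nat) (eps : R) (x0 : 'rV[R]_N)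
    (SI SII : strategy N eps) : probability (play R N) R :=
  distribution (coin_prob R) (random_play x0 SI SII).

Lemma history_of_random_play (R : realType) (N : nat) (eps : R)
    (x0 : 'rV[R]_N) (SI SII : strategy N eps) (k : nat) (t : R) :
  history_of k (random_play x0 SI SII t) = random_history x0 SI SII k t.
Proof.
elim: k => [|k IH]; first by congr pair; apply: eq_from_tnth => -[].
rewrite /history_of/= /next_history/=; congr pair; rewrite -[in RHS]IH /=.
apply: eq_from_tnth => i; rewrite tnth_mktuple (tnth_nth point)/= nth_rcons.
rewrite size_tuple ?card_ord; case: ltnP => [ik|ki].
  by have := tnth_nth point [tuple random_play x0 SI SII t j | j < k]
    (Ordinal ik); rewrite tnth_mktuple => ->.
have ik : nat_of_ord i = k by apply/eqP; rewrite eqn_leq ki -ltnS ltn_ord.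
by rewrite ik eqxx /random_play IH.
Qed.

(* The two lemmas below determine the finite-dimensional marginals of the law
   of the play: it starts at x0, and given the history of length k the next
   position is a^I or a^II with probability 1/2 each. *)
Lemma play_law_start (R : realType) (N : nat) (eps : R) (x0 : 'rV[R]_N)
    (SI SII : strategy N eps) (A : set (history R N 0)) :
  play_law x0 SI SII (@history_of R N 0 @^-1` A) =
  ((`[< A ([tuple], x0) >])%:R%:E : \bar R).
Proof.
transitivity (coin_prob R [set t | (fun=> A ([tuple], x0)) (dyadic 0 t)]).
  congr (coin_prob R _).
  by apply/seteqP; split=> t; rewrite /= history_of_random_play.
by rewrite (coin_prob_dyadic _ 0 (fun=> A ([tuple], x0))) big_ord1 expr0 invr1 mul1r.
Qed.

Lemma play_law_step (R : realType) (N : nat) (eps : R) (x0 : 'rV[R]_N)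
    (SI SII : strategy N eps) (k : nat) (A : set (history R N k.+1)) :
  (play_law x0 SI SII (@history_of R N k.+1 @^-1` A) =
   2^-1%:E * play_law x0 SI SII
     [set w | A (next_history SI SII true (history_of k w))] +
   2^-1%:E * play_law x0 SI SII
     [set w | A (next_history SI SII false (history_of k w))])%E.
Proof.
have law_of j (C : set (history R N j)) :
    play_law x0 SI SII (@history_of R N j @^-1` C) =
    ((2 ^- j * \sum_(n < 2 ^ j)
        (`[< C (digit_history x0 SI SII j n) >])%:R)%:E : \bar R).
  transitivity (coin_prob R
      [set t | (fun n => C (digit_history x0 SI SII j n)) (dyadic j t)]).
    congr (coin_prob R _).
    by apply/seteqP; split=> t; rewrite /= history_of_random_play random_historyE.
  by rewrite (coin_prob_dyadic _ j
    (fun n => C (digit_history x0 SI SII j n))).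
rewrite law_of (law_of k (fun h => A (next_history SI SII true h))).
rewrite (law_of k (fun h => A (next_history SI SII false h))).
rewrite -!EFinM -EFinD -!mulrDr mulrA -invfM -exprS.
rewrite -big_split/=; congr (_ * _)%:E.
pose f n : R := (`[< A (digit_history x0 SI SII k.+1 n) >])%:R.
have sum2 m : \sum_(0 <= n < m.*2) f n =
    \sum_(0 <= n < m) (f n.*2.+1 + f n.*2).
  elim: m => [|m IH]; first by rewrite !big_nil.
  by rewrite doubleS !big_nat_recr//= IH -addrA [f m.*2 + _]addrC.
rewrite -(big_mkord xpredT f) expnS mul2n sum2 big_mkord.
by apply: eq_bigr => n _; rewrite /f /= odd_double/= uphalf_double doubleK.
Qed.

Definition payoff (R : realType) (N : nat) (Om : set 'rV[R]_N) (gamma : R)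
    (F Psi : 'rV[R]_N -> R) (x : 'rV[R]_N) : R :=
  if `[< strip Om gamma x >] then F x else Psi x.

Definition ended (R : realType) (N : nat) (Om : set 'rV[R]_N) (gamma : R)
    (tau : stopping_rule R N) (w : play R N) (k : nat) : Prop :=
  tau w = k \/ strip Om gamma (position w k).

Definition terminates (R : realType) (N : nat) (Om : set 'rV[R]_N)
    (gamma : R) (tau : stopping_rule R N) (w : play R N) : Prop :=
  exists k, ended Om gamma tau w k.

(* The first stage at which the game has ended (0 if it never ends). *)
Definition final_stage (R : realType) (N : nat) (Om : set 'rV[R]_N)
    (gamma : R) (tau : stopping_rule R N) (w : play R N) : nat :=
  xget 0%N [set k | ended Om gamma tau w k /\
                    forall j, (j < k)%N -> ~ ended Om gamma tau w j].

Definition expected_payoff (R : realType) (N : nat) (Om : set 'rV[R]_N)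
    (gamma eps : R) (F Psi : 'rV[R]_N -> R) (x0 : 'rV[R]_N)
    (tau : stopping_rule R N) (SI SII : strategy N eps) : \bar R :=
  'E_(play_law x0 SI SII)[fun w =>
    payoff Om gamma F Psi (position w (final_stage Om gamma tau w))].

Definition terminates_ae (R : realType) (N : nat) (Om : set 'rV[R]_N)
    (gamma eps : R) (x0 : 'rV[R]_N)
    (tau : stopping_rule R N) (SI SII : strategy N eps) : Prop :=
  {ae play_law x0 SI SII, forall w, terminates Om gamma tau w}.

Definition V_I (R : realType) (N : nat) (Om : set 'rV[R]_N) (gamma eps : R)
    (F Psi : 'rV[R]_N -> R) (x0 : 'rV[R]_N)
    (tau : stopping_rule R N) (SI SII : strategy N eps) : \bar R :=
  if `[< terminates_ae Om gamma x0 tau SI SII >]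
  then expected_payoff Om gamma F Psi x0 tau SI SII else -oo%E.

Definition V_II (R : realType) (N : nat) (Om : set 'rV[R]_N) (gamma eps : R)
    (F Psi : 'rV[R]_N -> R) (x0 : 'rV[R]_N)
    (tau : stopping_rule R N) (SI SII : strategy N eps) : \bar R :=
  if `[< terminates_ae Om gamma x0 tau SI SII >]
  then expected_payoff Om gamma F Psi x0 tau SI SII else +oo%E.

Definition value_I (R : realType) (N : nat) (Om : set 'rV[R]_N)
    (gamma eps : R) (F Psi : 'rV[R]_N -> R) (x0 : 'rV[R]_N) : \bar R :=
  ereal_sup [set ereal_inf [set V_I Om gamma F Psi x0 tS.1 tS.2 SII
                           | SII in [set: strategy N eps]]
            | tS in [set: stopping_rule R N * strategy N eps]].

Definition value_II (R : realType) (N : nat) (Om : set 'rV[R]_N)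
    (gamma eps : R) (F Psi : 'rV[R]_N -> R) (x0 : 'rV[R]_N) : \bar R :=
  ereal_inf [set ereal_sup [set V_II Om gamma F Psi x0 tS.1 tS.2 SII
                           | tS in [set: stopping_rule R N * strategy N eps]]
            | SII in [set: strategy N eps]].

Definition is_game_value (R : realType) (N : nat) (Om : set 'rV[R]_N)
    (gamma eps : R) (F Psi : 'rV[R]_N -> R) (u : 'rV[R]_N -> \bar R) : Prop :=
  forall x, (Om `|` strip Om gamma) x ->
    u x = value_I Om gamma eps F Psi x /\ u x = value_II Om gamma eps F Psi x.

(* Main.v *)
Require Import Defs.
From mathcomp Require Import all_boot all_order all_algebra.
From mathcomp Require Import all_classical all_reals all_analysis.
Import Order.TTheory GRing.Theory Num.Theory.
Import numFieldNormedType.Exports.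
Local Open Scope classical_set_scope.
Local Open Scope ring_scope.

(** The law of the play, the stage at which it ends and the condition of almost
    sure termination depend on the starting point, the stopping rule and the
    strategies, but not on [F] and [Psi].  Raising [F] and [Psi] therefore only
    raises the random payoff, path by path, hence its expectation
    ([le_expectation]), hence the amount [V_I] received by Player I for each
    fixed choice of stopping rule and strategies ([le_V_I]).  A supremum of
    infima is monotone in the function to which it is applied, so the value for
    Player I increases ([le_value_I]); and that value is the value of the game.

    The expectations are compared through the definition of the Lebesgue
    integral, which is monotone on arbitrary functions
    ([le_integral_pointwise]). *)

(** The integral of a nonnegative function is the supremum over the simple
    functions below it, and there are more of these below a larger function;
    the positive and the negative part move in opposite directions.  With the
    convention [+oo - +oo = -oo] subtraction stays monotone in its first and
    antitone in its second argument, so the difference always follows. *)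
Lemma le_integral_pointwise (d : measure_display) (T : measurableType d)
    (R : realType) (mu : {measure set T -> \bar R}) (f g : T -> \bar R) :
  (forall x, (f x <= g x)%E) ->
  (\int[mu]_x f x <= \int[mu]_x g x)%E.
Proof.
move=> fg; rewrite /integral !patch_setT; apply: leeB.
  apply: ereal_sup_le => _ [h /= hf <-]; exists h => // x.
  by apply: le_trans (hf x) _; apply: (@funepos_le _ _ setT) => //; rewrite inE.
apply: ereal_sup_le => _ [h /= hg <-]; exists h => // x.
by apply: le_trans (hg x) _; apply: (@funeneg_le _ _ setT) => //; rewrite inE.
Qed.

Lemma le_expectation (d : measure_display) (T : measurableType d)
    (R : realType) (P : probability T R) (X Y : T -> R) :
  (forall w, X w <= Y w) -> ('E_P[X] <= 'E_P[Y])%E.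
Proof.
move=> XY; rewrite unlock; apply: le_integral_pointwise => w.
by rewrite lee_fin.
Qed.

Lemma le_ereal_sup_image (R : realType) (T : Type) (A : set T)
    (f g : T -> \bar R) :
  (forall t, (f t <= g t)%E) ->
  (ereal_sup [set f t | t in A] <= ereal_sup [set g t | t in A])%E.
Proof.
move=> fg; apply: ge_ereal_sup => _ [t At <-].
by apply: le_ereal_sup_tmp; exists (g t); [exists t | exact: fg].
Qed.

Lemma le_ereal_inf_image (R : realType) (T : Type) (A : set T)
    (f g : T -> \bar R) :
  (forall t, (f t <= g t)%E) ->
  (ereal_inf [set f t | t in A] <= ereal_inf [set g t | t in A])%E.
Proof.
move=> fg; apply: le_ereal_inf_tmp => _ [t At <-].
by apply: ge_ereal_inf; exists (f t); [exists t | exact: fg].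
Qed.

Lemma le_payoff (R : realType) (N : nat) (Om : set 'rV[R]_N) (gamma : R)
    (F F' Psi Psi' : 'rV[R]_N -> R) :
  (forall x, strip Om gamma x -> F x <= F' x) ->
  (forall x, Psi x <= Psi' x) ->
  forall x, payoff Om gamma F Psi x <= payoff Om gamma F' Psi' x.
Proof. by move=> FF' PP' x; rewrite /payoff; case: asboolP => // /FF'. Qed.

(** The two sides use the same law and the same final stage, and whether the
    penalty [-oo] applies is decided by the same termination event. *)
Lemma le_V_I (R : realType) (N : nat) (Om : set 'rV[R]_N) (gamma eps : R)
    (F F' Psi Psi' : 'rV[R]_N -> R) (x0 : 'rV[R]_N)
    (tau : stopping_rule R N) (SI SII : strategy N eps) :
  (forall x, strip Om gamma x -> F x <= F' x) ->
  (forall x, Psi x <= Psi' x) ->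
  (V_I Om gamma F Psi x0 tau SI SII <= V_I Om gamma F' Psi' x0 tau SI SII)%E.
Proof.
move=> FF' PP'; rewrite /V_I; case: ifP => // _.
by apply: le_expectation => w; exact: le_payoff.
Qed.

Lemma le_value_I (R : realType) (N : nat) (Om : set 'rV[R]_N) (gamma eps : R)
    (F F' Psi Psi' : 'rV[R]_N -> R) (x0 : 'rV[R]_N) :
  (forall x, strip Om gamma x -> F x <= F' x) ->
  (forall x, Psi x <= Psi' x) ->
  (value_I Om gamma eps F Psi x0 <= value_I Om gamma eps F' Psi' x0)%E.
Proof.
move=> FF' PP'; apply: le_ereal_sup_image => -[tau SI].
by apply: le_ereal_inf_image => SII; exact: le_V_I.
Qed.

Theorem lemma2 (R : realType) (N : nat) (Om : set 'rV[R]_N) (gamma eps : R)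
    (F1 F2 Psi1 Psi2 : 'rV[R]_N -> R) (u1 u2 : 'rV[R]_N -> \bar R)
    (N_gt0 : (0 < N)%N)
    (Om_smooth : bounded_smooth_domain Om)
    (gamma_gt0 : 0 < gamma)
    (eps_gt0 : 0 < eps) (eps_le : eps <= gamma)
    (data1 : obstacle_data Om gamma F1 Psi1)
    (data2 : obstacle_data Om gamma F2 Psi2)
    (u1_value : is_game_value Om gamma eps F1 Psi1 u1)
    (u2_value : is_game_value Om gamma eps F2 Psi2 u2)
    (F_ge : forall x, strip Om gamma x -> F2 x <= F1 x)
    (Psi_ge : forall x, Psi2 x <= Psi1 x) :
  forall x, (Om `|` strip Om gamma) x -> (u2 x <= u1 x)%E.
Proof.
move=> x Ox; have [-> _] := u1_value x Ox; have [-> _] := u2_value x Ox.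
exact: le_value_I.
Qed.
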